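(* If $G$ is a connected graph and $n$ is a positive integer, then $\chi_\mu(G\,\square\, K_n)\le \chi_{\mu_i}(G)$, and this bound is sharp (there are graphs for which equality holds).
   Context: All graphs are finite and simple. The Cartesian product $G\,\square\, H$ has vertex set $V(G)\times V(H)$, with $(g,h)$ adjacent to $(g',h')$ iff ($gg'\in E(G)$ and $h=h'$) or ($g=g'$ and $hh'\in E(H)$). A geodesic is a shortest path. For $X\subseteq V(G)$, two vertices $x,y\in X$ are $X$-visible if some $x,y$-geodesic has no internal vertex in $X$; $X$ is a mutual-visibility (MV) set if every two of its vertices are $X$-visible, and an independent mutual-visibility (IMV) set if moreover it is independent. $\chi_\mu(G)$ (resp. $\chi_{\mu_i}(G)$) is the least $k$ such that $V(G)$ can be partitioned into $k$ MV sets (resp. IMV sets). *)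

(* Defs.v *)
From mathcomp Require Import all_boot.

Set Implicit Arguments.
Unset Strict Implicit.
Unset Printing Implicit Defensive.

Record sgraph := SGraph {
  vertex :> finType;
  adj : rel vertex;
  adj_sym : symmetric adj;
  adj_irr : irreflexive adj }.

(* The graph with no vertices is not connected. *)
Definition connected_graph (G : sgraph) : bool :=
  (0 < #|G|) && [forall x : G, forall y : G, connect (@adj G) x y].

Section CartesianProduct.
Variables G H : sgraph.

Definition box_adj : rel (G * H) := fun u v =>
  (adj u.1 v.1 && (u.2 == v.2)) || ((u.1 == v.1) && adj u.2 v.2).

Lemma box_adj_sym : symmetric box_adj.
Proof.
move=> u v; rewrite /box_adj (adj_sym u.1) (adj_sym u.2).
by rewrite (eq_sym u.1) (eq_sym u.2).
Qed.

Lemma box_adj_irr : irreflexive box_adj.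
Proof. by move=> u; rewrite /box_adj !adj_irr andbF. Qed.

Definition box : sgraph := SGraph box_adj_sym box_adj_irr.

End CartesianProduct.

Section CompleteGraph.
Variable n : nat.

Definition complete_adj : rel 'I_n := fun i j => i != j.

Lemma complete_adj_sym : symmetric complete_adj.
Proof. by move=> i j; rewrite /complete_adj eq_sym. Qed.

Lemma complete_adj_irr : irreflexive complete_adj.
Proof. by move=> i; rewrite /complete_adj eqxx. Qed.

Definition complete : sgraph := SGraph complete_adj_sym complete_adj_irr.

End CompleteGraph.

Section Visibility.
Variable G : sgraph.
Implicit Types (x y : G) (p : seq G) (X : {set G}).

(* As in MathComp's [path], the vertices of the path are x :: p, so its length
   is size p. *)
Definition is_path x y p : bool :=
  [&& path (@adj G) x p, last x p == y & uniq (x :: p)].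

Definition geodesic x y p : bool :=
  is_path x y p &&
  [forall m : 'I_(size p), forall q : m.-tuple G, ~~ is_path x y q].

Lemma geodesicP x y p :
  reflect (is_path x y p /\ forall q, is_path x y q -> size p <= size q)
          (geodesic x y p).
Proof.
apply: (iffP andP) => -[pP minp]; split=> //.
  move=> q qP; rewrite leqNgt; apply/negP => lt_qp.
  have /forallP/(_ (in_tuple q)) := forallP minp (Ordinal lt_qp).
  by rewrite /= qP.
apply/forallP => m; apply/forallP => q; apply/negP => /minp.
by rewrite size_tuple leqNgt ltn_ord.
Qed.

Definition internal x p : seq G := behead (belast x p).

(* A path has fewer than #|G| edges, so bounding m loses nothing; see
   [visibleP]. *)
Definition visible X x y : bool :=
  [exists m : 'I_#|G|, exists p : m.-tuple G,
     geodesic x y p && all [predC X] (internal x p)].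

Lemma visibleP X x y :
  reflect (exists2 p, geodesic x y p & forall z, z \in internal x p -> z \notin X)
          (visible X x y).
Proof.
apply: (iffP existsP) => [[m /existsP[p /andP[gp /allP pX]]] | [p gp pX]].
  by exists p.
have lt_p : size p < #|G|.
  case/andP: gp => /and3P[_ _ /card_uniqP card_p] _.
  by have := max_card [in x :: p]; rewrite card_p.
exists (Ordinal lt_p); apply/existsP; exists (in_tuple p).
by rewrite gp; apply/allP.
Qed.

Lemma visible_refl X x : visible X x x.
Proof.
apply/visibleP; exists [::] => //.
by apply/geodesicP; rewrite /is_path /= eqxx.
Qed.

Definition mv_set X : bool := [forall x in X, forall y in X, visible X x y].

Definition independent X : bool := [forall x in X, forall y in X, ~~ adj x y].

Definition imv_set X : bool := mv_set X && independent X.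

Lemma mv_set1 x : mv_set [set x].
Proof.
apply/forall_inP => _ /set1P->.
by apply/forall_inP => _ /set1P->; apply: visible_refl.
Qed.

Lemma imv_set1 x : imv_set [set x].
Proof.
rewrite /imv_set mv_set1; apply/forall_inP => _ /set1P->.
by apply/forall_inP => _ /set1P->; rewrite adj_irr.
Qed.

Definition partitionable (Q : pred {set G}) (k : nat) : bool :=
  [exists P : {set {set G}},
     [&& partition P [set: G], #|P| == k & [forall X in P, Q X]]].

Lemma partitionable_set1 (Q : pred {set G}) :
  (forall x, Q [set x]) -> exists k, partitionable Q k.
Proof.
move=> Q1; exists #|preim_partition id [set: G]|.
apply/existsP; exists (preim_partition id [set: G]).
rewrite preim_partitionP eqxx; apply/forall_inP => _ /imsetP[x _ ->].
suff -> : [set y in [set: G] | x == y] = [set x] by apply: Q1.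
by apply/setP => y; rewrite !inE eq_sym.
Qed.

Definition chi_mu : nat := ex_minn (partitionable_set1 mv_set1).

Definition chi_mui : nat := ex_minn (partitionable_set1 imv_set1).

End Visibility.

(* Main.v *)
Require Import Defs.
From mathcomp Require Import all_boot.

(** If X is an IMV set of G, then X x V(K_n) is an MV set of the product.
    For distinct x, y in X, independence forces an X-avoiding x,y-geodesic to
    have an inner vertex z, and the geodesic can change its K_n-coordinate at
    z, outside X; an (x,i),(y,j)-walk has length at least d(x,y) + [i != j], so
    the lift is a geodesic. Hence an IMV partition of G pulls back to an MV
    partition of the product. Equality holds for G = K_1. *)

Set Implicit Arguments.
Unset Strict Implicit.
Unset Printing Implicit Defensive.

(** A walk can be shortened to a path on some of its vertices, and a shortest walk repeats no
    vertex. So lifts and projections need not be checked for repetitions. *)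
Lemma geodesic_walkP (G : sgraph) (x y : G) (p : seq G) :
  reflect [/\ path (@adj G) x p, last x p = y &
              forall q, path (@adj G) x q -> last x q = y -> size p <= size q]
          (geodesic x y p).
Proof.
apply: (iffP (geodesicP x y p)) => [[/and3P[pP /eqP lp _] minp]|[pP lp minp]].
  split=> // q qP lq; move: lq; case/shortenP: qP => q' q'P uq' sub_q' lq'.
  apply: (leq_trans (minp q' _)).
    by apply/and3P; split=> //; apply/eqP.
  by case/andP: uq' => _ uq'; apply: uniq_leq_size => // z; apply: sub_q'.
split; last by move=> q /and3P[qP /eqP lq _]; apply: minp.
apply/and3P; split=> //; first exact/eqP.
move: lp minp; case/shortenP: (pP) => p' p'P up' sub_p' lp' minp.
(* The shortened path uses only vertices of [x :: p] and, by minimality, is at least as long, so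
   [x :: p] is itself free of repetitions. *)
apply: (@leq_size_uniq _ (x :: p')) => //; last by rewrite ltnS minp.
by move=> z; rewrite !inE => /orP[->|/sub_p' ->] //; rewrite orbT.
Qed.

(** Projecting to [G] drops the steps along [H]. If the ends differ in their second coordinate, at
    least one step is dropped, which pays for the extra unit. *)
Lemma box_walk_fst (G H : sgraph) (u : box G H) (p : seq (box G H)) :
  path (@adj (box G H)) u p ->
  exists q, [/\ path (@adj G) u.1 q, last u.1 q = (last u p).1 &
                size q + (u.2 != (last u p).2) <= size p].
Proof.
elim: p u => [|v p IHp] u /=; first by exists [::]; rewrite /= eqxx.
case/andP=> /orP[/andP[uv /eqP euv]|/andP[/eqP euv _]] /IHp[q [qP lq sq]].
  by exists (v.1 :: q); rewrite /= uv qP lq euv addSn ltnS.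
exists q; rewrite euv; split=> //.
apply: leq_trans (_ : (size q).+1 <= _).
  by rewrite -addn1 leq_add2l leq_b1.
by rewrite ltnS (leq_trans _ sq) ?leq_addr.
Qed.

Lemma path_layer (G H : sgraph) (h : H) (x : G) (p : seq G) :
  path (@adj G) x p ->
  path (@adj (box G H)) (x, h) [seq (z, h) | z <- p].
Proof.
move=> pP; rewrite path_map; apply: sub_path pP => a b ab.
by rewrite /= /box_adj /= ab eqxx.
Qed.

Lemma imv_set_box_complete (G : sgraph) (n : nat) (X : {set G}) :
  imv_set X -> @mv_set (box G (complete n)) [set u | u.1 \in X].
Proof.
move=> /andP[mvX indX].
apply/forall_inP => -[x i]; rewrite inE /= => xX.
apply/forall_inP => -[y j]; rewrite inE /= => yX.
case: (eqVneq i j) => [<-{j}|ij].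
  have /visibleP[p /geodesic_walkP[pP lp minp] pX] :=
    forall_inP (forall_inP mvX x xX) y yX.
  apply/visibleP; exists [seq (z, i) | z <- p].
    apply/geodesic_walkP; split; first exact: path_layer.
      by rewrite last_map lp.
    move=> q /box_walk_fst[q' [q'P lq' sq]] lq; rewrite size_map.
    apply: leq_trans (leq_trans (leq_addr _ _) sq).
    by apply: minp => //; rewrite lq' lq.
  rewrite /internal (belast_map (fun z => (z, i))) behead_map.
  by move=> u /mapP[z zp ->]; rewrite inE pX.
(* Two copies of the same vertex in different layers are adjacent, so the geodesic is a single
   edge. *)
case: (eqVneq x y) => [<-{yX}|xy].
  apply/visibleP; exists [:: (x, j)] => //; apply/geodesic_walkP; split=> //.
    by rewrite /= /box_adj /= /complete_adj eqxx ij orbT.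
  by case=> // _ [] ij'; rewrite ij' eqxx in ij.
(* Length 0 contradicts [x != y] and length 1 contradicts independence; otherwise [z] is an inner
   vertex, hence outside [X]. *)
have /visibleP[[|z [|z' p]] /geodesic_walkP[pP lp minp] pX] :=
  forall_inP (forall_inP mvX x xX) y yX.
- by rewrite /= in lp; rewrite lp eqxx in xy.
- rewrite /= andbT in pP lp; rewrite lp in pP.
  by have := forall_inP (forall_inP indX x xX) y yX; rewrite pP.
set p' := z' :: p in pP lp minp pX.
have /andP[xz zP] := pP.
apply/visibleP; exists [:: (z, i), (z, j) & [seq (w, j) | w <- p']].
  apply/geodesic_walkP; split.
  - apply/and3P; split; last exact: (@path_layer G (complete n) j z p' zP).
      by rewrite /= /box_adj /= xz eqxx.
    by rewrite /= /box_adj /= /complete_adj eqxx ij orbT.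
  - by rewrite 2!last_cons (last_map (fun w => (w, j))) -lp.
  move=> q /box_walk_fst[q' [q'P lq' sq]] lq; apply: leq_trans sq.
  rewrite lq /= ij addn1 size_map ltnS.
  by apply: minp => //; rewrite lq' lq.
(* Both copies of [z] are inner vertices of the lift; every inner vertex projects to an inner vertex
   of the geodesic in [G]. *)
move=> u; rewrite -[internal _ _]/((z, i) :: belast (z, j) [seq (w, j) | w <- p']).
rewrite (belast_map (fun w => (w, j))).
rewrite inE => /orP[/eqP->|/mapP[w wp ->]]; rewrite inE /=; apply: pX => //.
by rewrite inE eqxx.
Qed.

(** Preimages preserve covering and disjointness; surjectivity keeps the blocks nonempty. *)
Lemma partition_preimset (aT rT : finType) (f : aT -> rT) (P : {set {set rT}}) :
  (forall y, exists x, f x = y) -> partition P [set: rT] ->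
  partition [set f @^-1: (B : {set rT}) | B in P] [set: aT].
Proof.
move=> f_surj /and3P[/eqP covP /trivIsetP trivP P0]; apply/and3P; split.
- apply/eqP/setP => x; rewrite inE; apply/bigcupP.
  have /bigcupP[B BP fxB] : f x \in cover P by rewrite covP inE.
  by exists (f @^-1: B); [apply: imset_f | rewrite inE].
- apply/trivIsetP => _ _ /imsetP[A AP ->] /imsetP[B BP ->] neqAB.
  have : A != B by apply: contraNneq neqAB => ->.
  move/(trivP _ _ AP BP); rewrite -!setI_eq0 -preimsetI => /eqP->.
  by rewrite preimset0.
apply/imsetP => -[B BP fB0]; case: (set_0Vmem B) => [B0|[y yB]].
  by rewrite -B0 BP in P0.
have [x fx] := f_surj y.
by have := in_set0 x; rewrite fB0 inE fx yB.
Qed.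

Lemma chi_mu_box_complete_le (G : sgraph) (n : nat) :
  0 < n -> chi_mu (box G (complete n)) <= chi_mui G.
Proof.
move=> n_gt0; rewrite /chi_mui; case: ex_minnP => k.
case/existsP=> P /and3P[partP /eqP<- /forall_inP imvP] _.
pose f (u : box G (complete n)) : G := u.1.
apply: leq_trans (leq_imset_card (fun B : {set G} => f @^-1: B) (mem P)).
rewrite /chi_mu; case: ex_minnP => m _; apply.
apply/existsP; exists [set f @^-1: (B : {set G}) | B in P].
rewrite eqxx partition_preimset //=; last by move=> x; exists (x, Ordinal n_gt0).
apply/forall_inP => _ /imsetP[B /imvP imvB ->].
exact: imv_set_box_complete imvB.
Qed.

Lemma chi_mu_gt0 (G : sgraph) : 0 < #|G| -> 0 < chi_mu G.
Proof.
case/card_gt0P=> x _; rewrite /chi_mu; case: ex_minnP => k.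
case/existsP=> P /and3P[/and3P[/eqP covP _ _] /eqP<- _] _.
have /bigcupP[B BP _] : x \in cover P by rewrite covP inE.
by apply/card_gt0P; exists B.
Qed.

Lemma chi_mui_le_card (G : sgraph) : chi_mui G <= #|G|.
Proof.
rewrite /chi_mui; case: ex_minnP => k _ kmin.
(* This is the partition into singletons. *)
pose P := preim_partition id [set: G].
apply: leq_trans (_ : #|P| <= _); last first.
  by rewrite -cardsT; apply: leq_imset_card.
apply: kmin; apply/existsP; exists P.
rewrite preim_partitionP eqxx; apply/forall_inP => _ /imsetP[x _ ->].
suff -> : [set y in [set: G] | x == y] = [set x] by apply: imv_set1.
by apply/setP => y; rewrite !inE eq_sym.
Qed.

Theorem theorem5p2 (n : nat) (n_gt0 : 0 < n) :
  (forall G : sgraph,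
     connected_graph G -> chi_mu (box G (complete n)) <= chi_mui G) /\
  (exists G : sgraph,
     connected_graph G /\ chi_mu (box G (complete n)) = chi_mui G).
Proof.
split=> [G _|]; first exact: chi_mu_box_complete_le.
exists (complete 1); split.
  rewrite /connected_graph card_ord; apply/forallP => x; apply/forallP => y.
  by rewrite (ord1 x) (ord1 y) connect0.
(* For the reverse inequality, [chi_mui] of the one-vertex graph is at most 1, while the product is
   nonempty and needs at least one class. *)
apply/eqP; rewrite eqn_leq chi_mu_box_complete_le //=.
apply: leq_trans (chi_mui_le_card _) _; rewrite card_ord.
by apply: chi_mu_gt0; rewrite card_prod !card_ord mul1n.
Qed.
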